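(* Let $\phi,\xi: I\to\mathbb{Q}_v$ be unit speed semi-real quaternionic involute-evolute curves ($\phi$ being the involute of $\xi$). If $\xi$ is a semi-real quaternionic $w$-curve, then the Serret-Frenet frame of $\phi$ is $$T_\phi(s^* )=\varepsilon_{N_\xi}N_\xi,\qquad N_\phi(s^* )=\frac{-\varepsilon_t\kappa_\xi T_\xi+\varepsilon_n\varepsilon_{N_\xi}kB_\xi}{\sqrt{\left|\varepsilon_n\varepsilon_{T_\xi}k^2+\varepsilon_{T_\xi}\kappa_\xi^2\right|}},$$ $$B_\phi(s^* )=\eta\,\varepsilon_n\varepsilon_b\varepsilon_{b^*}E_\xi,\qquad E_\phi(s^* )=-\eta\,\varepsilon_n\varepsilon_{T_\xi}\frac{\varepsilon_{N_\xi}kT_\xi+\varepsilon_t\kappa_\xi B_\xi}{\sqrt{\left|\varepsilon_{T_\xi}k^2+\varepsilon_n\varepsilon_{T_\xi}\kappa_\xi^2\right|}},$$ where the right-hand sides are evaluated at $s$ and $\eta=\pm1$.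
   Context: $\mathbb{Q}_v$ denotes the space of semi-real quaternions $q=q_1\mathbf e_1+q_2\mathbf e_2+q_3\mathbf e_3+q_4$, identified with the semi-Euclidean space $\mathbb{E}_2^4$ with form $h(p,q)=p_1q_1+p_2q_2-p_3q_3-p_4q_4$ and norm $N(q)=\sqrt{|h(q,q)|}$. The products satisfy $\mathbf e_i\times\mathbf e_i=-\varepsilon_{e_i}$, and for $(ijk)$ an even permutation of $(123)$, $\mathbf e_i\times\mathbf e_j=\varepsilon_{e_i}\varepsilon_{e_j}\mathbf e_k$ in $\mathbb{R}_1^3$ and $\mathbf e_i\times\mathbf e_j=-\varepsilon_{e_i}\varepsilon_{e_j}\mathbf e_k$ in $\mathbb{R}_2^4$, with $\varepsilon_{e_i}\in\{\pm1\}$. For a unit speed curve $\xi$ with arc-length parameter $s$, the Serret-Frenet apparatus is $T=\xi'$, $N=\xi''/N(\xi'')$, $B=\eta\varepsilon_n\varepsilon_T(E\wedge_{\mathbb L}T\wedge_{\mathbb L}N)$, $E=-\eta\varepsilon_n\varepsilon_b\varepsilon_T\varepsilon_N\dfrac{T\wedge_{\mathbb L}N\wedge_{\mathbb L}\xi'''}{N(T\wedge_{\mathbb L}N\wedge_{\mathbb L}\xi''')}$, where $\wedge_{\mathbb L}$ is the ternary vector product of $\mathbb{E}_2^4$ and $\eta=\pm1$ is chosen so that $\det(T,N,B,E)=+1$. The Serret-Frenet equations are $T'=\varepsilon_N\kappa N$, $N'=-\varepsilon_t\varepsilon_N\kappa T+\varepsilon_nkB$, $B'=-\varepsilon_tkN+\varepsilon_n(r-\varepsilon_t\varepsilon_T\varepsilon_N\kappa)E$,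 $E'=-\varepsilon_b(r-\varepsilon_t\varepsilon_T\varepsilon_N\kappa)B$, with $h(T,T)=\varepsilon_T$, $h(N,N)=\varepsilon_N$, $h(B,B)=\varepsilon_n\varepsilon_T$, $h(E,E)=\varepsilon_b\varepsilon_T$. Here $t,n,b$ (with $h(t,t)=\varepsilon_t$, $h(n,n)=\varepsilon_n$, $h(b,b)=\varepsilon_b$, all $\pm1$) is the Frenet frame and $k,r$ are the curvature and torsion of the associated semi-real spatial quaternionic curve in $\mathbb{R}_1^3$, determined by $N=\varepsilon_T(t\times T)$, $B=\varepsilon_T(n\times T)$, $E=\varepsilon_T(b\times T)$. The subscripts $\xi,\phi$ indicate the curve; $t,n,b,k,r$ belong to $\xi$ and the starred symbols $t^*,n^*,b^*$ belong to $\phi$. A semi-real quaternionic $w$-curve is one whose curvatures $\kappa,\ k,\ r-\varepsilon_t\varepsilon_T\varepsilon_N\kappa$ are all constant. The curves $\phi$ (arc-length parameter $s^*$) and $\xi$ (arc-length parameter $s$) are semi-real quaternionic involute-evolute curves, $\phi$ the involute, if $h(T_\phi(s^* ),T_\xi(s))=0$ at corresponding points, where $\phi(s^* )=\xi(s)+\lambda(s)T_\xi(s)$; then $\phi(s^* )=\xi(s)+(c-s)T_\xi(s)$ for a real constant $c$. The parameter $s^*$ is oriented by $\dfrac{ds^*}{ds}=(c-s)\kappa_\xi$. The curves are assumed non-degenerate so that all Frenet frames exist and all denominators are nonzero.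
   Formalization: The single η is replaced by signs η_B, η_E with η_E = ε_t·η_B, since for ε_t = -1 the printed frame has determinant -1, not +1; and ds*/ds = (c-s)κ_ξ > 0 is assumed, since otherwise N_φ is minus the stated vector. *)

(* Defs.v *)
From HB Require Import structures.
From mathcomp Require Import all_boot all_order all_algebra.
From mathcomp Require Import all_classical all_reals all_analysis.
Set Implicit Arguments.
Unset Strict Implicit.
Unset Printing Implicit Defensive.
Import Order.TTheory GRing.Theory Num.Theory.
Import numFieldNormedType.Exports.
Local Open Scope classical_set_scope.
Local Open Scope ring_scope.

(* The semi-real quaternion q1 e1 + q2 e2 + q3 e3 + q4 is the row vector       *)
(* (q1, q2, q3, q4) : 'rV[R]_4.  Coordinates are numbered from 0, so q 0 3 is  *)
(* the scalar part q4.                                                         *)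

Section Quaternions.
Context {R : realType}.
Implicit Types p q a b c d : 'rV[R]_4.

Definition is_sign (x : R) : Prop := x = 1 \/ x = -1.

(* signature (+, +, -, -) *)
Definition qsig (i : 'I_4) : R := if (i < 2)%N then 1 else -1.

Definition qform p q : R := \sum_(i < 4) qsig i * p 0 i * q 0 i.

Definition qnorm q : R := Num.sqrt `|qform q q|.

Definition rows4 a b c d : 'M[R]_4 := \matrix_(i < 4) [:: a; b; c; d]`_i.

(* The formal determinant with first row (e1, e2, -e3, -e4), i.e. the vector   *)
(* with qform x (qwedge a b c) = det (x, a, b, c).  The Serret-Frenet frames   *)
(* below do not depend on this choice of sign, since eta is fixed by the       *)
(* orientation of the frame.                                                   *)
Definition qwedge a b c : 'rV[R]_4 :=
  \row_j (qsig j * \det (rows4 (delta_mx 0 j) a b c)).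

(* The product in R_2^4: ei x ei = - eps_i and ei x ej = - eps_i eps_j ek for  *)
(* (i j k) an even permutation (the opposite sign for an odd one).  The signs  *)
(* eps_i are a parameter e; eps_1, eps_2, eps_3 are e 0, e 1, e 2.  The        *)
(* product is associative when eps_1 eps_2 eps_3 = 1.                          *)
Definition qmul (e : 'I_3 -> R) p q : 'rV[R]_4 :=
  \row_(j < 4) [::
    p 0 3 * q 0 0 + p 0 0 * q 0 3 - e 1 * e 2 * (p 0 1 * q 0 2 - p 0 2 * q 0 1);
    p 0 3 * q 0 1 + p 0 1 * q 0 3 - e 2 * e 0 * (p 0 2 * q 0 0 - p 0 0 * q 0 2);
    p 0 3 * q 0 2 + p 0 2 * q 0 3 - e 0 * e 1 * (p 0 0 * q 0 1 - p 0 1 * q 0 0);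
    p 0 3 * q 0 3 -
      (e 0 * p 0 0 * q 0 0 + e 1 * p 0 1 * q 0 1 + e 2 * p 0 2 * q 0 2)]`_j.

Definition spatial q : Prop := q 0 3 = 0.

(* The form on spatial quaternions for which ei has causal sign eps_i.  For    *)
(* eps = (1, 1, -1) it is the restriction of qform; for eps = (-1, -1, 1) it   *)
(* is the opposite of that restriction and qmul is multiplicative for it:      *)
(* qform (t x q) (t x q) = sform t t * qform q q when t is spatial.            *)
Definition sform (e : 'I_3 -> R) p q : R :=
  e 0 * p 0 0 * q 0 0 + e 1 * p 0 1 * q 0 1 + e 2 * p 0 2 * q 0 2.

End Quaternions.

(* sf_t, sf_n, sf_b, sf_k, sf_r are the frame, the curvature and the torsion   *)
(* of the associated spatial curve.                                            *)
Record apparatus (R : realType) := Apparatus {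
  sf_T : R -> 'rV[R]_4;
  sf_N : R -> 'rV[R]_4;
  sf_B : R -> 'rV[R]_4;
  sf_E : R -> 'rV[R]_4;
  sf_kappa : R -> R;
  sf_k : R -> R;
  sf_r : R -> R;
  sf_t : R -> 'rV[R]_4;
  sf_n : R -> 'rV[R]_4;
  sf_b : R -> 'rV[R]_4;
  eps_T : R;
  eps_N : R;
  eps_t : R;
  eps_n : R;
  eps_b : R;
  sf_eta : R }.

Section SerretFrenet.
Context {R : realType}.
Implicit Types (I J : set R) (xi phi : R -> 'rV[R]_4) (F : apparatus R).

Definition sf_tau F (s : R) : R :=
  sf_r F s - eps_t F * eps_T F * eps_N F * sf_kappa F s.

Record serret_frenet (e : 'I_3 -> R) I xi F : Prop := SerretFrenet {
  sf_signs : [/\ is_sign (eps_T F), is_sign (eps_N F) & is_sign (sf_eta F)];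
  sf_spatial_signs :
    [/\ is_sign (eps_t F), is_sign (eps_n F) & is_sign (eps_b F)];
  sf_derivable : forall s, I s ->
    forall m, (m < 3)%N -> derivable (derive1n m xi) s 1;
  sf_TE : forall s, I s -> sf_T F s = derive1 xi s;
  sf_N_neq0 : forall s, I s -> qnorm (derive1n 2 xi s) != 0;
  sf_NE : forall s, I s ->
    sf_N F s = (qnorm (derive1n 2 xi s))^-1 *: derive1n 2 xi s;
  sf_BE : forall s, I s ->
    sf_B F s = (sf_eta F * eps_n F * eps_T F) *:
      qwedge (sf_E F s) (sf_T F s) (sf_N F s);
  sf_E_neq0 : forall s, I s ->
    qnorm (qwedge (sf_T F s) (sf_N F s) (derive1n 3 xi s)) != 0;
  sf_EE : forall s, I s ->
    let w := qwedge (sf_T F s) (sf_N F s) (derive1n 3 xi s) in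
    sf_E F s =
      - (sf_eta F * eps_n F * eps_b F * eps_T F * eps_N F) *: ((qnorm w)^-1 *: w);
  sf_det : forall s, I s ->
    \det (rows4 (sf_T F s) (sf_N F s) (sf_B F s) (sf_E F s)) = 1;
  sf_hT : forall s, I s -> qform (sf_T F s) (sf_T F s) = eps_T F;
  sf_hN : forall s, I s -> qform (sf_N F s) (sf_N F s) = eps_N F;
  sf_hB : forall s, I s -> qform (sf_B F s) (sf_B F s) = eps_n F * eps_T F;
  sf_hE : forall s, I s -> qform (sf_E F s) (sf_E F s) = eps_b F * eps_T F;
  sf_dT : forall s, I s ->
    is_derive s 1 (sf_T F) ((eps_N F * sf_kappa F s) *: sf_N F s);
  sf_dN : forall s, I s ->
    is_derive s 1 (sf_N F)
      (- (eps_t F * eps_N F * sf_kappa F s) *: sf_T F s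
       + (eps_n F * sf_k F s) *: sf_B F s);
  sf_dB : forall s, I s ->
    is_derive s 1 (sf_B F)
      (- (eps_t F * sf_k F s) *: sf_N F s
       + (eps_n F * sf_tau F s) *: sf_E F s);
  sf_dE : forall s, I s ->
    is_derive s 1 (sf_E F) (- (eps_b F * sf_tau F s) *: sf_B F s);
  sf_spatial : forall s, I s ->
    [/\ spatial (sf_t F s), spatial (sf_n F s) & spatial (sf_b F s)];
  sf_spatial_unit : forall s, I s ->
    [/\ sform e (sf_t F s) (sf_t F s) = eps_t F,
        sform e (sf_n F s) (sf_n F s) = eps_n F
      & sform e (sf_b F s) (sf_b F s) = eps_b F];
  sf_spatial_orth : forall s, I s ->
    [/\ sform e (sf_t F s) (sf_n F s) = 0,
        sform e (sf_t F s) (sf_b F s) = 0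
      & sform e (sf_n F s) (sf_b F s) = 0];
  sf_spatial_frame : forall s, I s ->
    [/\ sf_N F s = eps_T F *: qmul e (sf_t F s) (sf_T F s),
        sf_B F s = eps_T F *: qmul e (sf_n F s) (sf_T F s)
      & sf_E F s = eps_T F *: qmul e (sf_b F s) (sf_T F s)] }.

Definition w_curve I F : Prop :=
  [/\ exists a, forall s, I s -> sf_kappa F s = a,
      exists a, forall s, I s -> sf_k F s = a
    & exists a, forall s, I s -> sf_tau F s = a].

(* sigma maps the parameter s of xi to the parameter s* of the corresponding   *)
(* point of phi.                                                               *)
Definition involute_evolute I J (sigma : R -> R) phi xi Fphi Fxi : Prop :=
  exists lam : R -> R, forall s, I s ->
    [/\ J (sigma s),
        phi (sigma s) = xi s + lam s *: sf_T Fxi s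
      & qform (sf_T Fphi (sigma s)) (sf_T Fxi s) = 0].

End SerretFrenet.

(* Main.v *)
(* Differentiating phi (sigma s) = xi s + (c - s) T s once gives
   T_phi = eps_N N.  Differentiating twice more, with constant curvatures, the
   second derivative of phi is a positive multiple of
   V = - eps_t kappa T + eps_n eps_N k B, and the ternary product of T_phi, N_phi
   and the third derivative is a positive multiple of eps_n eps_T k tau U with
   U = eps_N k T + eps_t kappa B.  So N_phi, E_phi and B_phi are V, U and E up to
   normalisation and sign, and the sign of k tau is constant.

   The relation etaE = eps_t etaB between the two remaining signs amounts to
   eps_N = eps_t eps_T.  In the opposite case the Gram matrix of p |-> p x T on
   spatial quaternions forces t to be, up to sign, a fixed axis e_i, and
   h(t x T, T) = 0 becomes T_i T_4 = 0.  Differentiating along the curve shows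
   that T, hence N, hence B (as k <> 0), have vanishing i-th and 4-th coordinates,
   so that T, N, B would be dependent. *)
Require Import Defs.
From mathcomp Require Import all_boot all_order all_algebra.
From mathcomp Require Import all_classical all_reals all_analysis.
From mathcomp Require Import ring lra.
Set Implicit Arguments.
Unset Strict Implicit.
Unset Printing Implicit Defensive.
Import Order.TTheory GRing.Theory Num.Theory.
Import numFieldNormedType.Exports.
Local Open Scope classical_set_scope.
Local Open Scope ring_scope.

(* Expanding big sums over ordinals produces indices [lift ord0 (lift ...)]. *)
Ltac norm_ord :=
  repeat match goal with |- context [fun_of_matrix _ ?i ?j] =>
    let k := match i with
      | context [lift] => i
      | _ => match j with context [lift] => j end end in
    let x := eval vm_compute in (nat_of_ord k) in
    match x with
    | 0%N => rewrite (_ : k = 0); last exact/val_inj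
    | 1%N => rewrite (_ : k = 1); last exact/val_inj
    | 2%N => rewrite (_ : k = 2); last exact/val_inj
    | 3%N => rewrite (_ : k = 3); last exact/val_inj
    end end.

(** * Small determinants in closed form *)

Section Determinants.
Context {R : comRingType}.

Lemma det_mx22 (A : 'M[R]_2) : \det A = A 0 0 * A 1 1 - A 0 1 * A 1 0.
Proof.
rewrite (expand_det_row _ 0) !big_ord_recl big_ord0 /cofactor !det_mx11 !mxE /=.
norm_ord; ring.
Qed.

Lemma det_mx33 (A : 'M[R]_3) : \det A =
  A 0 0 * (A 1 1 * A 2 2 - A 1 2 * A 2 1)
  - A 0 1 * (A 1 0 * A 2 2 - A 1 2 * A 2 0)
  + A 0 2 * (A 1 0 * A 2 1 - A 1 1 * A 2 0).
Proof.
rewrite (expand_det_row _ 0) !big_ord_recl big_ord0 /cofactor !det_mx22 !mxE /=.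
norm_ord; ring.
Qed.

End Determinants.

(** * Coordinates of the form and of the ternary product *)

Section LinAlg.
Context {R : realType}.
Implicit Types p q a b c d : 'rV[R]_4.

(** Laplace expansion along the first two rows; [m] gives the complementary minors of the last
    two. *)
Lemma det_rows4 a b c d : \det (rows4 a b c d) =
  let m (i j : 'I_4) := c 0 i * d 0 j - c 0 j * d 0 i in
  (a 0 0 * b 0 1 - a 0 1 * b 0 0) * m 2 3
  - (a 0 0 * b 0 2 - a 0 2 * b 0 0) * m 1 3
  + (a 0 0 * b 0 3 - a 0 3 * b 0 0) * m 1 2
  + (a 0 1 * b 0 2 - a 0 2 * b 0 1) * m 0 3
  - (a 0 1 * b 0 3 - a 0 3 * b 0 1) * m 0 2
  + (a 0 2 * b 0 3 - a 0 3 * b 0 2) * m 0 1.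
Proof.
rewrite (expand_det_row _ 0) !big_ord_recl big_ord0 /cofactor !det_mx33 !mxE /=.
norm_ord; ring.
Qed.

Lemma row4P p q :
  p 0 0 = q 0 0 -> p 0 1 = q 0 1 -> p 0 2 = q 0 2 -> p 0 3 = q 0 3 -> p = q.
Proof.
move=> h0 h1 h2 h3; apply/rowP => -[[|[|[|[|//]]]] hi].
- by rewrite (_ : Ordinal hi = 0); last exact/val_inj.
- by rewrite (_ : Ordinal hi = 1); last exact/val_inj.
- by rewrite (_ : Ordinal hi = 2); last exact/val_inj.
- by rewrite (_ : Ordinal hi = 3); last exact/val_inj.
Qed.

Lemma qformE p q :
  qform p q = p 0 0 * q 0 0 + p 0 1 * q 0 1 - p 0 2 * q 0 2 - p 0 3 * q 0 3.
Proof.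
rewrite /qform !big_ord_recl big_ord0 /qsig /=; norm_ord; ring.
Qed.

Lemma qformC p q : qform p q = qform q p.
Proof. by rewrite !qformE; ring. Qed.

Lemma qformDl p q a : qform (p + q) a = qform p a + qform q a.
Proof. by rewrite !qformE !mxE; ring. Qed.

Lemma qformZl x p q : qform (x *: p) q = x * qform p q.
Proof. by rewrite !qformE !mxE; ring. Qed.

Lemma qformDr p q a : qform a (p + q) = qform a p + qform a q.
Proof. by rewrite !qformE !mxE; ring. Qed.

Lemma qformZr x p q : qform p (x *: q) = x * qform p q.
Proof. by rewrite !qformE !mxE; ring. Qed.

Lemma qwedgeE a b c :
  let m (i j : 'I_4) := b 0 i * c 0 j - b 0 j * c 0 i in
  [/\ qwedge a b c 0 0 = a 0 1 * m 2 3 - a 0 2 * m 1 3 + a 0 3 * m 1 2,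
      qwedge a b c 0 1 = - (a 0 0 * m 2 3 - a 0 2 * m 0 3 + a 0 3 * m 0 2),
      qwedge a b c 0 2 = - (a 0 0 * m 1 3 - a 0 1 * m 0 3 + a 0 3 * m 0 1)
    & qwedge a b c 0 3 = a 0 0 * m 1 2 - a 0 1 * m 0 2 + a 0 2 * m 0 1].
Proof. by rewrite /=; split; rewrite !mxE det_rows4 /qsig !mxE /=; ring. Qed.

Lemma qform_qwedge p a b c : qform p (qwedge a b c) = \det (rows4 p a b c).
Proof.
by rewrite qformE det_rows4; have [-> -> -> ->] := qwedgeE a b c; rewrite /=; ring.
Qed.

Lemma qwedgeDl p q b c : qwedge (p + q) b c = qwedge p b c + qwedge q b c.
Proof.
have [a0 a1 a2 a3] := qwedgeE (p + q) b c.
have [p0 p1 p2 p3] := qwedgeE p b c; have [q0 q1 q2 q3] := qwedgeE q b c.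
apply: row4P; rewrite [in RHS]mxE.
- by rewrite a0 p0 q0 !mxE; ring.
- by rewrite a1 p1 q1 !mxE; ring.
- by rewrite a2 p2 q2 !mxE; ring.
- by rewrite a3 p3 q3 !mxE; ring.
Qed.

Lemma qwedgeZl x p b c : qwedge (x *: p) b c = x *: qwedge p b c.
Proof.
have [a0 a1 a2 a3] := qwedgeE (x *: p) b c.
have [p0 p1 p2 p3] := qwedgeE p b c.
apply: row4P; rewrite [in RHS]mxE.
- by rewrite a0 p0 !mxE; ring.
- by rewrite a1 p1 !mxE; ring.
- by rewrite a2 p2 !mxE; ring.
- by rewrite a3 p3 !mxE; ring.
Qed.

(** A cyclic permutation of three vectors is even. Linearity in the first slot is carried to the
    other two slots by this rotation. *)
Lemma qwedge_rot a b c : qwedge a b c = qwedge b c a.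
Proof.
have [a0 a1 a2 a3] := qwedgeE a b c.
have [b0 b1 b2 b3] := qwedgeE b c a.
apply: row4P; rewrite ?a0 ?a1 ?a2 ?a3 ?b0 ?b1 ?b2 ?b3; ring.
Qed.

Lemma qwedge_aa a b : qwedge a a b = 0.
Proof.
have [a0 a1 a2 a3] := qwedgeE a a b.
apply: row4P; rewrite ?a0 ?a1 ?a2 ?a3 [RHS]mxE; ring.
Qed.
End LinAlg.

(** * Orthonormal frames in signature (2, 2) *)

Section Frames.
Context {R : realType}.
Implicit Types p q a b c d : 'rV[R]_4.

Lemma signV (x : R) : is_sign x -> x * x = 1.
Proof. by case=> ->; rewrite ?mulrNN mulr1. Qed.

Lemma signM (x y : R) : is_sign x -> is_sign y -> is_sign (x * y).
Proof.
by case=> -> [] ->; rewrite ?mulrNN ?mulr1 ?mul1r; [left|right|right|left].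
Qed.

Lemma gram_rows4 a b c d :
  rows4 a b c d *m diag_mx (\row_i qsig i) *m (rows4 a b c d)^T =
  \matrix_(i < 4, j < 4) qform [:: a; b; c; d]`_i [:: a; b; c; d]`_j.
Proof.
apply/matrixP => i j; rewrite mul_mx_diag !mxE /qform.
by apply: eq_bigr => l _; rewrite !mxE [X in X * _]mulrC.
Qed.

(** The column of the numbers [qsig i * p 0 i] lies in the kernel of an invertible matrix. *)
Lemma qform_nondegenerate a b c d p : \det (rows4 a b c d) != 0 ->
  qform a p = 0 -> qform b p = 0 -> qform c p = 0 -> qform d p = 0 -> p = 0.
Proof.
move=> D0 ha hb hc hd.
have U : rows4 a b c d \in unitmx by rewrite unitmxE unitfE.
pose q := \col_i (qsig i * p 0 i).
have q0 : rows4 a b c d *m q = 0.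
  apply/matrixP => i j; rewrite [RHS]mxE.
  transitivity (qform [:: a; b; c; d]`_i p).
    by rewrite mxE /qform; apply: eq_bigr => l _; rewrite !mxE mulrCA mulrA.
  by case: i => -[|[|[|[|//]]]].
have {}q0 : q = 0 by rewrite -(mulKmx U q) q0 mulmx0.
apply/rowP => i; have := congr1 (fun u : 'cV_4 => u i 0) q0.
rewrite !mxE /qsig; case: ifP => _; rewrite ?mul1r // mulN1r.
by move/eqP; rewrite oppr_eq0 => /eqP.
Qed.

(** The derivative-free content of a Frenet apparatus, for which [eB] and [eE] become
    [eps_n * eps_T] and [eps_b * eps_T]. *)
Record frame (T N B E : 'rV[R]_4) (eT eN eB eE : R) : Prop := Frame {
  frame_signs : [/\ is_sign eT, is_sign eN, is_sign eB & is_sign eE];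
  frame_norms :
    [/\ qform T T = eT, qform N N = eN, qform B B = eB & qform E E = eE];
  frame_orthT : [/\ qform T N = 0, qform T B = 0 & qform T E = 0];
  frame_orthN : [/\ qform N B = 0, qform N E = 0 & qform B E = 0];
  frame_det : \det (rows4 T N B E) = 1 }.

(** By [qform_qwedge] both sides pair equally with each of [a], [b], [c], [d], and the form is
    nondegenerate. *)
Lemma qwedge_orth a b c d : \det (rows4 a b c d) != 0 -> is_sign (qform a a) ->
  [/\ qform a b = 0, qform a c = 0 & qform a d = 0] ->
  qwedge b c d = (\det (rows4 a b c d) * qform a a) *: a.
Proof.
move=> D0 sa [hb hc hd]; apply/eqP; rewrite -subr_eq0; apply/eqP.
apply: (qform_nondegenerate D0); rewrite -scaleN1r qformDr !qformZr qform_qwedge.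
- by rewrite -mulrA (signV sa) mulr1 mulN1r subrr.
- by rewrite (qformC b) hb !mulr0 addr0 det_rows4 /=; ring.
- by rewrite (qformC c) hc !mulr0 addr0 det_rows4 /=; ring.
- by rewrite (qformC d) hd !mulr0 addr0 det_rows4 /=; ring.
Qed.

Section Frame.
Variables (T N B E : 'rV[R]_4) (eT eN eB eE : R).
Hypothesis F : frame T N B E eT eN eB eE.

(** Compare determinants in the Gram identity: the frame has determinant 1, and the signature
    contributes two minus signs. *)
Lemma frame_sign_prod : eT * eN * eB * eE = 1.
Proof.
case: F => _ [hT hN hB hE] [TN TB TE] [NB NE BE] D.
have := congr1 determinant (gram_rows4 T N B E).
rewrite !det_mulmx det_tr D det_diag mul1r mulr1 !big_ord_recl big_ord0.
rewrite !mxE /qsig /= mulr1 mulrNN !mulr1 => ->.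
transitivity (\det (diag_mx (\row_(i < 4) [:: eT; eN; eB; eE]`_i))).
  by rewrite det_diag !big_ord_recl big_ord0 !mxE /= mulr1 !mulrA.
congr (\det _); apply/matrixP => i j; rewrite !mxE.
by case: i => -[|[|[|[|//]]]] ?; case: j => -[|[|[|[|//]]]] ? /=;
  rewrite ?mulr1n ?mulr0n // qformC.
Qed.

Lemma frame_qwedge : [/\ qwedge N B E = eT *: T, qwedge N T E = - eB *: B
  & qwedge T N B = - eE *: E].
Proof.
case: F => -[sT sN sB sE] [hT hN hB hE] [TN TB TE] [NB NE BE] D.
have DB : \det (rows4 B N T E) = -1 by rewrite -D !det_rows4 /=; ring.
have DE : \det (rows4 E T N B) = -1 by rewrite -D !det_rows4 /=; ring.
split.
- by rewrite (@qwedge_orth T) ?D ?oner_eq0 ?hT ?mul1r.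
- rewrite (@qwedge_orth B) ?DB ?hB ?mulN1r ?oppr_eq0 ?oner_eq0 //.
  by rewrite !(qformC B) ?NB ?TB (qformC E).
- rewrite (@qwedge_orth E) ?DE ?hE ?mulN1r ?oppr_eq0 ?oner_eq0 //.
  by rewrite !(qformC E).
Qed.

End Frame.

(** [B] and [E] are multiples of ternary products, hence orthogonal to their factors; only the
    orthogonality of [T] and [N] is supplied from outside. *)
Lemma serret_frenet_frame (e : 'I_3 -> R) (I : set R) (xi : R -> 'rV[R]_4)
    (F : apparatus R) (s : R) : serret_frenet e I xi F -> I s ->
  qform (sf_T F s) (sf_N F s) = 0 ->
  frame (sf_T F s) (sf_N F s) (sf_B F s) (sf_E F s)
    (eps_T F) (eps_N F) (eps_n F * eps_T F) (eps_b F * eps_T F).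
Proof.
move=> H Is TN.
have [[sT sN _] [_ sn sb]] := (sf_signs H, sf_spatial_signs H).
have hB p : qform p (sf_B F s) = sf_eta F * eps_n F * eps_T F *
    \det (rows4 p (sf_E F s) (sf_T F s) (sf_N F s)).
  by rewrite {1}(sf_BE H Is) qformZr qform_qwedge.
have hE p : exists x, qform p (sf_E F s) =
    x * \det (rows4 p (sf_T F s) (sf_N F s) (derive1n 3 xi s)).
  rewrite (sf_EE H Is) /= 2!qformZr mulrA qform_qwedge; eexists; reflexivity.
split.
- by split => //; apply: signM.
- by rewrite (sf_hT H Is) (sf_hN H Is) (sf_hB H Is) (sf_hE H Is).
- split=> //; first by rewrite hB det_rows4 /=; ring.
  by have [x ->] := hE (sf_T F s); rewrite det_rows4 /=; ring.
- split; first by rewrite hB det_rows4 /=; ring.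
  + by have [x ->] := hE (sf_N F s); rewrite det_rows4 /=; ring.
  + by rewrite qformC hB det_rows4 /=; ring.
- exact: (sf_det H Is).
Qed.

(** The rows [B, E, T, N] are an even rearrangement of the frame, so the formula for [B] gives h(B,
    B) = eta eps_n eps_T, while the causal sign of [B] is eps_n eps_T. *)
Lemma serret_frenet_eta (e : 'I_3 -> R) (I : set R) (xi : R -> 'rV[R]_4)
    (F : apparatus R) (s : R) : serret_frenet e I xi F -> I s -> sf_eta F = 1.
Proof.
move=> H Is; have [_ sn _] := sf_spatial_signs H; have [sT _ _] := sf_signs H.
have := sf_hB H Is; rewrite {2}(sf_BE H Is) qformZr qform_qwedge.
have -> : \det (rows4 (sf_B F s) (sf_E F s) (sf_T F s) (sf_N F s)) = 1.
  by rewrite -(sf_det H Is) !det_rows4 /=; ring.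
by case: sn => ->; case: sT => -> h; lra.
Qed.

End Frames.

(** * Scalar case analysis for the exceptional sign *)

Section AxisScalars.
Context {R : realType}.

Lemma N1_eq1 : (-1 == 1 :> R) = false.
Proof. by apply/negbTE/eqP => h; lra. Qed.

(** One of [a], [b] is zero, and a square equal to plus or minus the other square then makes both
    vanish. *)
Lemma sq_cross (a b x : R) : a * b = 0 -> x != 0 ->
  x * (b ^+ 2 - a ^+ 2) = 0 \/ x * (b ^+ 2 + a ^+ 2) = 0 -> a = 0 /\ b = 0.
Proof.
move=> ab x0 h; have {h x0} ab2 : b ^+ 2 = a ^+ 2 \/ b ^+ 2 = - a ^+ 2.
  case: h => /eqP; rewrite mulf_eq0 (negbTE x0) /= => /eqP h; [left|right]; lra.
have sq0 (y : R) : y ^+ 2 = 0 -> y = 0.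
  by move=> /eqP; rewrite expf_eq0 /= => /eqP.
move/eqP: ab; rewrite mulf_eq0 => /orP[] /eqP z; split => //; apply: sq0;
  case: ab2; rewrite z => h; lra.
Qed.

(** Each [et * t_i ^ 2] is 0, 1 or -1. Nonnegativity of squares and the norm of [t] leave exactly
    one nonzero coordinate, in a position fixed by the signs [e_i]. *)
Lemma axis_cases (et e0 e1 e2 t0 t1 t2 : R) :
  is_sign et -> is_sign e0 -> is_sign e1 -> is_sign e2 ->
  2 * (et * t0 ^+ 2) = e0 + 1 -> 2 * (et * t1 ^+ 2) = e1 + 1 ->
  2 * (et * t2 ^+ 2) = e2 - 1 ->
  e0 * t0 ^+ 2 + e1 * t1 ^+ 2 + e2 * t2 ^+ 2 = et ->
  [\/ [/\ e0 = 1, e1 = -1 & e2 = 1] /\ [/\ t0 != 0, t1 = 0 & t2 = 0],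
      [/\ e0 = -1, e1 = 1 & e2 = 1] /\ [/\ t0 = 0, t1 != 0 & t2 = 0]
    | [/\ e0 = -1, e1 = -1 & e2 = -1] /\ [/\ t0 = 0, t1 = 0 & t2 != 0]].
Proof.
move=> st s0 s1 s2 k0 k1 k2 tt.
have sq0 (x : R) : x ^+ 2 = 0 -> x = 0.
  by move=> /eqP; rewrite expf_eq0 /= => /eqP.
have sqN0 (x : R) : x ^+ 2 = 1 -> x != 0.
  by move=> h; apply/eqP => x0; move: h; rewrite x0 expr0n /= => h; lra.
have p0 := sqr_ge0 t0; have p1 := sqr_ge0 t1; have p2 := sqr_ge0 t2.
move: k0 k1 k2 tt.
case: s0 => ->; case: s1 => ->; case: s2 => ->; case: st => -> k0 k1 k2 tt;
  try (exfalso; lra).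
- by apply: Or31; split; split=> //; do 1?[apply: sq0|apply: sqN0]; lra.
- by apply: Or32; split; split=> //; do 1?[apply: sq0|apply: sqN0]; lra.
- by apply: Or33; split; split=> //; do 1?[apply: sq0|apply: sqN0]; lra.
Qed.

End AxisScalars.

(** * Spatial frames multiplied by the tangent *)

Section Spatial.
Context {R : realType}.
Implicit Types p q t n b : 'rV[R]_4.
Variable e : 'I_3 -> R.

Lemma qmulDl p q T : qmul e (p + q) T = qmul e p T + qmul e q T.
Proof. by apply: row4P; rewrite !mxE /=; ring. Qed.

Lemma qmulZl x p T : qmul e (x *: p) T = x *: qmul e p T.
Proof. by apply: row4P; rewrite !mxE /=; ring. Qed.

Hypothesis he : forall i, is_sign (e i).

(** Completeness relation of an orthonormal frame. Orthonormality is [M S M^T = D] with [S] and [D]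
    involutive; inverses commute, so [M^T D M = S], whose row [i] is the claim. *)
Lemma sform_complete t n b (et en eb : R) :
  [/\ is_sign et, is_sign en & is_sign eb] ->
  [/\ spatial t, spatial n & spatial b] ->
  [/\ sform e t t = et, sform e n n = en & sform e b b = eb] ->
  [/\ sform e t n = 0, sform e t b = 0 & sform e n b = 0] ->
  forall i : 'I_3, let i4 := widen_ord (leqnSn 3) i in
  (et * t 0 i4) *: t + (en * n 0 i4) *: n + (eb * b 0 i4) *: b =
  e i *: delta_mx 0 i4.
Proof.
move=> [st sn sb] [t3 n3 b3] [tt nn bb] [tn tb nb] i i4.
pose w (j : 'I_3) : 'I_4 := widen_ord (leqnSn 3) j.
pose M := \matrix_(l < 3, j < 3) [:: t; n; b]`_l 0 (w j).
pose S := diag_mx (\row_j e j).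
pose D := diag_mx (\row_(l < 3) [:: et; en; eb]`_l).
have sC p q : sform e p q = sform e q p by rewrite /sform; ring.
have MSM : M *m S *m M^T = D.
  apply/matrixP => l j; rewrite mul_mx_diag !mxE.
  transitivity (sform e [:: t; n; b]`_l [:: t; n; b]`_j).
    rewrite !big_ord_recl big_ord0 !mxE addr0 /sform addrA.
    rewrite (_ : lift ord0 (lift _ _) = 2); last exact/val_inj.
    rewrite (_ : lift ord0 _ = 1); last exact/val_inj.
    rewrite (_ : w 0 = 0); last exact/val_inj.
    rewrite (_ : w 1 = 1); last exact/val_inj.
    rewrite (_ : w 2 = 2); last exact/val_inj.
    ring.
  by case: l => -[|[|[|//]]] ?; case: j => -[|[|[|//]]] ? /=;
    rewrite ?mulr1n ?mulr0n // sC.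
have DD : D *m D = 1%:M.
  apply/matrixP => l j; rewrite mul_mx_diag !mxE mulrnAl.
  by case: l => -[|[|[|//]]] ? /=; case: j => -[|[|[|//]]] ? /=;
    rewrite ?mulr0n ?mulr1n ?signV.
have SS : S *m S = 1%:M.
  by apply/matrixP => l j; rewrite mul_mx_diag !mxE mulrnAl;
    case: eqP => [->|_] /=; rewrite ?mulr0n ?mulr1n ?signV.
have /mulmx1C C1 : (M *m S) *m (M^T *m D) = 1%:M by rewrite mulmxA MSM DD.
have {}C1 : (M^T *m D) *m M = S.
  by rewrite -[LHS]mulmx1 -SS !mulmxA -(mulmxA (M^T *m D)) C1 mul1mx.
have C j : (et * t 0 i4) * t 0 (w j) + (en * n 0 i4) * n 0 (w j) +
    (eb * b 0 i4) * b 0 (w j) = e i *+ (i == j).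
  have := congr1 (fun A : 'M[R]_3 => A i j) C1.
  rewrite mul_mx_diag !mxE !big_ord_recl big_ord0 !mxE /= => <-.
  rewrite -/(w i) -/i4; ring.
have dE j : (w j == i4) = (i == j) by rewrite eq_sym -!val_eqE.
apply: row4P; rewrite !mxE /=.
- rewrite (_ : 0 = w 0) ?dE ?C ?mulr_natr //; exact/val_inj.
- rewrite (_ : 1 = w 1) ?dE ?C ?mulr_natr //; exact/val_inj.
- rewrite (_ : 2 = w 2) ?dE ?C ?mulr_natr //; exact/val_inj.
- rewrite t3 n3 b3 !mulr0 !addr0 (_ : (_ == i4) = false) ?mulr0 //.
  by apply/negbTE; rewrite -val_eqE /= gtn_eqF.
Qed.

(** Up to signs, multiplication by the first or second axis exchanges positive coordinates with
    negative ones, whereas the third axis permutes within each kind. *)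
Lemma qform_qmul_axis T :
  [/\ qform (qmul e (delta_mx 0 0) T) (qmul e (delta_mx 0 0) T) = - qform T T,
      qform (qmul e (delta_mx 0 1) T) (qmul e (delta_mx 0 1) T) = - qform T T
    & qform (qmul e (delta_mx 0 2) T) (qmul e (delta_mx 0 2) T) = qform T T].
Proof.
by split; rewrite !qformE !mxE /= ?mulr1n ?mulr0n;
  case: (he 0) => ->; case: (he 1) => ->; case: (he 2) => ->; ring.
Qed.

(* The only direction that t can have when eps_N = - eps_t eps_T. *)
Definition axis : 'I_4 := if e 0 == 1 then 0 else if e 1 == 1 then 1 else 2.

(** Norms of the products [e_i x T] force [t] onto one axis, and h(N, T) = 0 then reads as the first
    claim. [N] being a multiple of that axis times [T], its axis and scalar coordinates are
    multiples of [T 0 3] and [T 0 axis], so the second claim falls under [sq_cross]. Its premise is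
    what differentiating the first claim along a curve provides. *)
Lemma frame_axis T N B E t n b (eT eN et en eb : R) :
  frame T N B E eT eN (en * eT) (eb * eT) ->
  [/\ is_sign et, is_sign en & is_sign eb] ->
  [/\ spatial t, spatial n & spatial b] ->
  [/\ sform e t t = et, sform e n n = en & sform e b b = eb] ->
  [/\ sform e t n = 0, sform e t b = 0 & sform e n b = 0] ->
  [/\ N = eT *: qmul e t T, B = eT *: qmul e n T & E = eT *: qmul e b T] ->
  eN = - (et * eT) ->
  T 0 axis * T 0 3 = 0 /\
  (N 0 axis * T 0 3 + T 0 axis * N 0 3 = 0 -> T 0 axis = 0 /\ T 0 3 = 0).
Proof.
move=> F sg sp un orth [NE BE EE] eNE.
have [[sT _ _ _] [hT hN hB hE] [TN TB TE] [NB NX BX] _] := F.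
have [st sn sb] := sg; have [t3 _ _] := sp; have [tt _ _] := un.
have sT2 := signV sT; have st2 := signV st; have sn2 := signV sn.
have sb2 := signV sb.
have qE p q : q = eT *: qmul e p T -> qmul e p T = eT *: q.
  by move=> ->; rewrite scalerA sT2 scale1r.
(* From e_i = e i (et t_i t + en n_i n + eb b_i b), the square norm of e_i x T
   in terms of N, B, E. *)
have key i : let i4 := widen_ord (leqnSn 3) i in
    2 * (et * t 0 i4 ^+ 2) = e i - eT *
      qform (qmul e (delta_mx 0 i4) T) (qmul e (delta_mx 0 i4) T).
  move=> i4; have h := sform_complete sg sp un orth i.
  have := congr1 (fun v : 'rV_4 => v 0 i4) h; rewrite !mxE !eqxx /= mulr1 => h1.
  have := congr1 (fun v => qmul e v T) h; rewrite !qmulDl !qmulZl.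
  rewrite (qE _ _ NE) (qE _ _ BE) (qE _ _ EE) => /(congr1 (fun v => qform v v)).
  rewrite !(qformDl, qformDr, qformZl, qformZr) hN hB hE.
  rewrite NB NX BX (qformC B) (qformC E) (qformC E B) NB NX BX.
  rewrite [in RHS]mulrA (signV (he i)) mul1r -h1 eNE => <-.
  (* Because [eN = - (et * eT)], the [t] terms of [e i] and of the norm add up, while the [n] and
     [b] terms cancel. *)
  transitivity (et * t 0 i4 ^+ 2 * (1 + (et * et) * (eT * eT) * (eT * eT))
     + en * n 0 i4 ^+ 2 * (1 - (en * en) * (eT * eT) * (eT * eT))
     + eb * b 0 i4 ^+ 2 * (1 - (eb * eb) * (eT * eT) * (eT * eT))).
    by rewrite st2 sn2 sb2 sT2; ring.
  by rewrite -/i4; ring.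
have [a0 a1 a2] := qform_qmul_axis T; rewrite hT in a0 a1 a2.
have {}t3 : t 0 3 = 0 := t3.
have k0 := key 0; have k1 := key 1; have k2 := key 2.
rewrite /= (_ : widen_ord _ 0 = 0) in k0; last exact/val_inj.
rewrite /= (_ : widen_ord _ 1 = 1) in k1; last exact/val_inj.
rewrite /= (_ : widen_ord _ 2 = 2) in k2; last exact/val_inj.
rewrite a0 mulrN sT2 opprK in k0; rewrite a1 mulrN sT2 opprK in k1.
rewrite a2 sT2 in k2.
have TNq := TN; rewrite NE qformZr qformE !mxE /= in TNq.
rewrite NE !mxE /= /axis.
have eT0 : eT != 0 by case: sT => ->; rewrite ?oppr_eq0 oner_eq0.
move/eqP: TNq; rewrite mulf_eq0 (negbTE eT0) /= => /eqP TNq.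
rewrite /sform in tt.
have two0 : 2 != 0 :> R by rewrite pnatr_eq0.
have [|||] := axis_cases st (he 0) (he 1) (he 2) k0 k1 k2.
- by rewrite !expr2 !mulrA.
all: case=> -[e0 e1 e2] [z0 z1 z2]; rewrite e0 e1 e2 ?(eqxx, N1_eq1).
all: rewrite ?z0 ?z1 ?z2 t3 e0 e1 e2 in TNq *.
- have p : T 0 0 * T 0 3 = 0.
    apply: (mulfI z0); rewrite mulr0; apply: (mulfI two0).
    by rewrite mulr0 -TNq; ring.
  split=> // h; apply: (sq_cross p (x := eT * t 0 0)); first by rewrite mulf_neq0.
  by left; rewrite -[RHS]h /=; ring.
- have p : T 0 1 * T 0 3 = 0.
    apply: (mulfI z1); rewrite mulr0; apply: (mulfI two0).
    by rewrite mulr0 -TNq; ring.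
  split=> // h; apply: (sq_cross p (x := eT * t 0 1)); first by rewrite mulf_neq0.
  by left; rewrite -[RHS]h /=; ring.
- have p : T 0 2 * T 0 3 = 0.
    apply: (mulfI z2); rewrite mulr0; apply: (mulfI two0).
    by rewrite mulr0 -[RHS]oppr0 -[in RHS]TNq; ring.
  split=> // h; apply: (sq_cross p (x := eT * t 0 2)); first by rewrite mulf_neq0.
  by right; rewrite -[RHS]h /=; ring.
Qed.

End Spatial.

(** * Derivatives of vector-valued functions *)

Section Calculus.
Context {R : realType}.

Lemma is_derive_entry n (f : R -> 'rV[R]_n) (s : R) (df : 'rV[R]_n) (j : 'I_n) :
  is_derive s 1 f df -> is_derive s 1 (fun t => f t 0 j) (df 0 j).
Proof.
move=> [f1 <-]; have /derivable_mxP/(_ 0 j) fj := f1.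
by apply: DeriveDef => //; rewrite derive_mx // mxE.
Qed.

Lemma is_derive_entries n (f : R -> 'rV[R]_n) (s : R) (df : 'rV[R]_n) :
  (forall j, is_derive s 1 (fun t => f t 0 j) (df 0 j)) -> is_derive s 1 f df.
Proof.
move=> h; have f1 : derivable f s 1.
  by apply/derivable_mxP => i j; rewrite ord1; have [] := h j.
apply: DeriveDef => //; rewrite derive_mx //; apply/rowP => j; rewrite mxE.
by have [_ ->] := h j.
Qed.

Lemma is_derive_scale n (u : R -> R) (f : R -> 'rV[R]_n) (s du : R) (df : 'rV[R]_n) :
  is_derive s 1 u du -> is_derive s 1 f df ->
  is_derive s 1 (fun t => u t *: f t) (u s *: df + du *: f s).
Proof.
move=> hu hf; apply: is_derive_entries => j.
rewrite !mxE (mulrC du).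
have -> : (fun t => (u t *: f t) 0 j) = u * (fun t => f t 0 j).
  by apply/funext => t; rewrite mxE.
exact/is_deriveM/is_derive_entry.
Qed.

Lemma is_derive_compV (V : normedModType R) (sg : R -> R) (f : R -> V)
    (s c : R) (v : V) :
  is_derive s 1 sg c -> is_derive (sg s) 1 f v ->
  is_derive s 1 (f \o sg) (c *: v).
Proof.
move=> [dsg <-] [df <-].
have Dsg := dsg; have Df := df.
move/derivable1_diffP : Dsg => Dsg; move/derivable1_diffP : Df => Df.
have D := differentiable_comp Dsg Df.
apply: DeriveDef; first exact/derivable1_diffP.
rewrite -!derive1E derive1E' // diff_comp //= deriv1E //=.
by rewrite deriv1E //= scale1r.
Qed.

(** Allows an identity that holds only on an open parameter set to be differentiated there. *)
Lemma is_derive_near_unique (V : normedModType R) (f g : R -> V) (A : set R)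
    (s : R) (df dg : V) : open A -> A s -> (forall t, A t -> f t = g t) ->
  is_derive s 1 f df -> is_derive s 1 g dg -> df = dg.
Proof.
move=> oA As fg hf hg.
have : is_derive s 1 g df.
  by apply: near_eq_is_derive hf; apply: filterS (open_nbhs_nbhs (conj oA As)).
by case=> _ <-; case: hg => _ <-.
Qed.

End Calculus.

(** * Exclusion of the sign eps_N = - eps_t eps_T *)

Lemma is_derive_entry0 (R : realType) n (f : R -> 'rV[R]_n) (A : set R) (s : R)
    (df : 'rV[R]_n) j :
  open A -> (forall t, A t -> f t 0 j = 0) -> A s -> is_derive s 1 f df ->
  df 0 j = 0.
Proof.
move=> oA f0 As hf.
exact: (is_derive_near_unique oA As f0 (is_derive_entry j hf) (is_derive_cst 0 s 1)).
Qed.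

Lemma serret_frenet_spatial_sign (R : realType) (e : 'I_3 -> R) (I : set R)
    (xi : R -> 'rV[R]_4) (F : apparatus R) (s : R) :
  (forall i, is_sign (e i)) -> open I -> serret_frenet e I xi F ->
  (forall s, I s -> sf_kappa F s != 0) -> (forall s, I s -> sf_k F s != 0) ->
  (forall s, I s -> qform (sf_T F s) (sf_N F s) = 0) -> I s ->
  eps_N F = eps_t F * eps_T F.
Proof.
move=> he oI H k0 kk0 TN Is.
have [[sT sN _] [st sn sb]] := (sf_signs H, sf_spatial_signs H).
have [//|eNE] : eps_N F = eps_t F * eps_T F \/ eps_N F = - (eps_t F * eps_T F).
  by case: sN => ->; case: st => ->; case: sT => ->;
    rewrite ?mulrNN ?mulr1 ?mul1r ?opprK;
    [left|right|right|left|right|left|left|right].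
have s0 (x : R) : is_sign x -> x != 0.
  by case=> ->; rewrite ?oppr_eq0 oner_eq0.
pose i := axis e.
have P t (It : I t) := frame_axis he (serret_frenet_frame H It (TN t It))
  (sf_spatial_signs H) (sf_spatial H It) (sf_spatial_unit H It)
  (sf_spatial_orth H It) (sf_spatial_frame H It) eNE.
(* The derivative of [T_i T_4] is [eps_N * kappa], a nonzero number, times the premise of the second
   claim of [frame_axis]. *)
have T0 t (It : I t) : sf_T F t 0 i = 0 /\ sf_T F t 0 3 = 0.
  apply: (P t It).2.
  have dT := sf_dT H It.
  have := is_derive_near_unique oI It (fun t It => (P t It).1)
    (is_deriveM (is_derive_entry i dT) (is_derive_entry 3 dT)) (is_derive_cst 0 t 1).
  rewrite !mxE /GRing.scale /= => h.
  apply: (mulfI (s0 _ sN)); apply: (mulfI (k0 t It)).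
  by rewrite !mulr0 -[RHS]h -/i; ring.
(* [T'] is a nonzero multiple of [N], and below [N'] has a nonzero [B] coefficient, so a coordinate
   vanishing along [T] vanishes along [N] and then along [B]. *)
have N0 j : (forall t, I t -> sf_T F t 0 j = 0) -> forall t, I t -> sf_N F t 0 j = 0.
  move=> Tj t It; have := is_derive_entry0 oI Tj It (sf_dT H It).
  rewrite mxE => /eqP.
  by rewrite !mulf_eq0 (negbTE (s0 _ sN)) (negbTE (k0 t It)) => /eqP.
have B0 j : (forall t, I t -> sf_T F t 0 j = 0) -> forall t, I t -> sf_B F t 0 j = 0.
  move=> Tj t It; have := is_derive_entry0 oI (N0 j Tj) It (sf_dN H It).
  rewrite !mxE Tj // mulr0 add0r => /eqP.
  by rewrite !mulf_eq0 (negbTE (s0 _ sn)) (negbTE (kk0 t It)) => /eqP.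
have Ti t : I t -> sf_T F t 0 i = 0 by move=> /T0[].
have T3 t : I t -> sf_T F t 0 3 = 0 by move=> /T0[].
(* [T], [N], [B] lie in one coordinate plane, which contradicts determinant 1. *)
have := sf_det H Is; rewrite det_rows4 /=.
rewrite (T3 s Is) (N0 3 T3 s Is) (B0 3 T3 s Is).
have := Ti s Is; have := N0 i Ti s Is; have := B0 i Ti s Is.
rewrite /i /axis; case: ifP => _; last case: ifP => _.
all: move=> -> -> -> /eqP; rewrite [X in X == _](_ : _ = 0); last by ring.
all: by rewrite eq_sym oner_eq0.
Qed.

(** * Algebra of the involute frame at one point *)

Section Involute.
Context {R : realType}.
Implicit Types p q a b c d : 'rV[R]_4.

Lemma qnormZ (x : R) p : qnorm (x *: p) = `|x| * qnorm p.
Proof.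
rewrite /qnorm qformZl qformZr mulrA -expr2 normrM sqrtrM // normrX.
by rewrite sqrtr_sqr normr_id.
Qed.

(** Only the sign of the factor survives normalization; for [x = 0] both sides are zero. *)
Lemma normalizeZ (x : R) p :
  (qnorm (x *: p))^-1 *: (x *: p) = Num.sg x *: ((qnorm p)^-1 *: p).
Proof.
rewrite qnormZ; have [->|x0] := eqVneq x 0; first by rewrite sgr0 !scale0r scaler0.
rewrite !scalerA invfM; congr (_ *: _); rewrite mulrAC; congr (_ * _).
by rewrite {2}[x]numEsg mulrCA mulVf ?mulr1 // normr_eq0.
Qed.

Lemma qwedgeDm p q a b : qwedge a (p + q) b = qwedge a p b + qwedge a q b.
Proof.
by rewrite (qwedge_rot a (p + q)) (qwedge_rot a p) (qwedge_rot a q) qwedgeDl.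
Qed.

Lemma qwedgeZm (x : R) p a b : qwedge a (x *: p) b = x *: qwedge a p b.
Proof. by rewrite (qwedge_rot a (x *: p)) (qwedge_rot a p) qwedgeZl. Qed.

Lemma qwedgeDr p q a b : qwedge a b (p + q) = qwedge a b p + qwedge a b q.
Proof. by rewrite (qwedge_rot a b) qwedgeDm -!(qwedge_rot a b). Qed.

Lemma qwedgeZr (x : R) p a b : qwedge a b (x *: p) = x *: qwedge a b p.
Proof. by rewrite (qwedge_rot a b) qwedgeZm -(qwedge_rot a b). Qed.

Section Point.
Variables (T N B E : 'rV[R]_4) (eT eN et en eb kappa k tau : R).
Hypothesis F : frame T N B E eT eN (en * eT) (eb * eT).
Hypotheses (st : is_sign et) (sn : is_sign en).

(* V and U are the directions of the vectors N and E of the involute. *)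
Let V := - (et * kappa) *: T + (en * eN * k) *: B.
Let U := (eN * k) *: T + (et * kappa) *: B.
(** Both radicands of the final formulas equal [D] up to sign, so [V] and [U] have the same norm. *)
Let D := en * k ^+ 2 + kappa ^+ 2.

Lemma qform_involute_V : qform V V = eT * D.
Proof.
have [[_ sN _ _] [hT hN hB hE] [TN TB TE] [NB NX BX] _] := F.
rewrite /V !(qformDl, qformDr, qformZl, qformZr) hT hB (qformC B) TB.
have := signV st; have := signV sn; have := signV sN => h1 h2 h3.
transitivity (eT * (en * (en * en) * (eN * eN) * k ^+ 2 + (et * et) * kappa ^+ 2)).
  by ring.
by rewrite h1 h2 h3 /D; ring.
Qed.

Lemma qform_involute_U : qform U U = en * eT * D.
Proof.
have [[_ sN _ _] [hT hN hB hE] [TN TB TE] [NB NX BX] _] := F.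
rewrite /U !(qformDl, qformDr, qformZl, qformZr) hT hB (qformC B) TB.
have := signV st; have := signV sn; have := signV sN => h1 h2 h3.
transitivity (eT * ((eN * eN) * k ^+ 2 + (et * et) * en * kappa ^+ 2)).
  by ring.
rewrite h1 h3 /D; transitivity (eT * (en * en * k ^+ 2 + en * kappa ^+ 2)).
  by rewrite h2; ring.
by ring.
Qed.

Lemma qform_N_involute_V : qform N V = 0.
Proof.
have [_ _ [TN TB TE] [NB NX BX] _] := F.
by rewrite /V !(qformDl, qformDr, qformZl, qformZr) (qformC N) TN NB; ring.
Qed.

Lemma qwedge_N_V_E : qwedge N V E = (en * eT) *: U.
Proof.
have [wT wB _] := frame_qwedge F; have [[_ sN _ _] _ _ _ _] := F.
rewrite /V /U qwedgeDm !qwedgeZm wT wB scalerDr !scalerA addrC.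
by congr (_ *: _ + _ *: _); ring.
Qed.

(** In the bilinear expansion the terms with a repeated factor vanish; the other two are multiples
    of [T, N, B] in opposite orders. *)
Lemma qwedge_U_N_V : qwedge U N V = - (D * eb * eT) *: E.
Proof.
have [_ _ wE] := frame_qwedge F; have [[_ sN _ _] _ _ _ _] := F.
have BNT : qwedge B N T = -1 *: qwedge T N B.
  have [a0 a1 a2 a3] := qwedgeE B N T; have [b0 b1 b2 b3] := qwedgeE T N B.
  by apply: row4P; rewrite ?a0 ?a1 ?a2 ?a3 [RHS]mxE ?b0 ?b1 ?b2 ?b3 /=; ring.
have TNT : qwedge T N T = 0 by rewrite -qwedge_rot qwedge_aa.
have BNB : qwedge B N B = 0 by rewrite -qwedge_rot qwedge_aa.
rewrite /V /U qwedgeDl !qwedgeZl !qwedgeDr !qwedgeZr TNT BNB BNT wE.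
rewrite !scaler0 add0r addr0 !scalerA -scalerDl.
have := signV st; have := signV sN => h1 h3; congr (_ *: _).
transitivity (- (((eN * eN) * en * k ^+ 2 + (et * et) * kappa ^+ 2) * eb * eT)).
  by ring.
by rewrite h1 h3 /D; ring.
Qed.

(** The [A] and [N] parts of the third derivative are killed by the first two factors, so [y] and
    [z] can stay arbitrary. The cube collects one [u^-1] from [A] and two from [A3]. *)
Lemma qwedge_involute (u y z : R) (A A3 : 'rV[R]_4) : u != 0 ->
  u *: A = V -> u *: (u *: A3) = y *: A + (z *: N + (eN * k * tau) *: E) ->
  qwedge (eN *: N) ((qnorm A)^-1 *: A) A3 =
    ((qnorm A)^-1 * u^-1 ^+ 3 * (en * eT) * (k * tau)) *: U.
Proof.
move=> u0 uA uA3; have [[_ sN _ _] _ _ _ _] := F.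
have AE : A = u^-1 *: V by rewrite -uA scalerA mulVf ?scale1r.
have A3E : A3 = (u^-1 ^+ 2) *: (y *: A + (z *: N + (eN * k * tau) *: E)).
  by rewrite -uA3 !scalerA [X in X *: _](_ : _ = 1) ?scale1r //; field.
rewrite A3E qwedgeZl qwedgeZm qwedgeZr !qwedgeDr !qwedgeZr.
have -> : qwedge N A A = 0 by rewrite qwedge_rot qwedge_aa.
have -> : qwedge N A N = 0 by rewrite -qwedge_rot qwedge_aa.
rewrite !scaler0 !add0r {2}AE qwedgeZm qwedge_N_V_E !scalerA.
have := signV sN => h; congr (_ *: _).
transitivity ((eN * eN) * (qnorm A)^-1 * u^-1 ^+ 3 * (en * eT) * (k * tau)).
  by ring.
by rewrite h mul1r.
Qed.

End Point.
End Involute.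

(** * The involute frame computed from its derivatives *)

Section InvoluteApparatus.
Context {R : realType}.
Variables (e : 'I_3 -> R) (I J : set R) (xi phi : R -> 'rV[R]_4).
Variables (Fxi Fphi : apparatus R) (s s' u y z : R).
Hypotheses (hxi : serret_frenet e I xi Fxi) (hphi : serret_frenet e J phi Fphi).
Hypotheses (Is : I s) (Js : J s') (u_gt0 : 0 < u).
Hypothesis TN : qform (sf_T Fxi s) (sf_N Fxi s) = 0.

Local Notation eT := (eps_T Fxi).
Local Notation eN := (eps_N Fxi).
Local Notation et := (eps_t Fxi).
Local Notation en := (eps_n Fxi).
Local Notation eb := (eps_b Fxi).
Local Notation T := (sf_T Fxi s).
Local Notation N := (sf_N Fxi s).
Local Notation B := (sf_B Fxi s).
Local Notation E := (sf_E Fxi s).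
Local Notation kappa := (sf_kappa Fxi s).
Local Notation k := (sf_k Fxi s).
Local Notation tau := (sf_tau Fxi s).
Local Notation V := (- (et * kappa) *: T + (en * eN * k) *: B).
Local Notation U := ((eN * k) *: T + (et * kappa) *: B).
Local Notation D := (en * k ^+ 2 + kappa ^+ 2).

Hypothesis hT : sf_T Fphi s' = eN *: N.
Hypothesis hA : u *: derive1n 2 phi s' = V.
Hypothesis hA3 : u *: (u *: derive1n 3 phi s') =
  y *: derive1n 2 phi s' + (z *: N + (eN * k * tau) *: E).

Let F := serret_frenet_frame hxi Is TN.
Let u_neq0 : u != 0. Proof. by rewrite gt_eqF. Qed.

Let qwedgeE : exists2 x, 0 < x &
  qwedge (sf_T Fphi s') (sf_N Fphi s') (derive1n 3 phi s') =
    (x * (en * eT) * (k * tau)) *: U.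
Proof.
have [_ sn _] := sf_spatial_signs hxi; have [st _ sb] := sf_spatial_signs hxi.
exists ((qnorm (derive1n 2 phi s'))^-1 * u^-1 ^+ 3).
  rewrite mulr_gt0 ?exprn_gt0 ?invr_gt0 //.
  by rewrite lt_def sqrtr_ge0 (sf_N_neq0 hphi Js).
by rewrite hT (sf_NE hphi Js) (qwedge_involute F u_neq0 hA hA3).
Qed.

(** If [k * tau] vanished, so would the ternary product that is normalized to define the vector [E]
    of the involute. *)
Lemma involute_torsion_neq0 : k * tau != 0.
Proof.
have [x _ w] := qwedgeE; have := sf_E_neq0 hphi Js; rewrite w.
by apply: contra_neq => ->; rewrite mulr0 scale0r /qnorm qformE !mxE !mul0r
  !subr0 addr0 normr0 sqrtr0.
Qed.

Hypothesis eNE : eN = et * eT.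

(** [etaE] joins the sign of [k * tau], left by normalization, to the causal signs in the definition
    of [E]. [B] then follows from [qwedge_U_N_V], with its sign reduced by the sign product of the
    new frame. *)
Lemma involute_apparatus :
  let etaE := Num.sg (k * tau) *
    (eps_n Fphi * eps_b Fphi * eps_T Fphi * eps_N Fphi) in
  let etaB := et * etaE in
  [/\ sf_N Fphi s' =
        (Num.sqrt `|en * eT * k ^+ 2 + eT * kappa ^+ 2|)^-1 *: V,
      sf_B Fphi s' = (etaB * en * eb * eps_b Fphi) *: E
    & sf_E Fphi s' = - (etaE * en * eT) *:
        ((Num.sqrt `|eT * k ^+ 2 + en * eT * kappa ^+ 2|)^-1 *: U)].
Proof.
move=> etaE etaB.
have sp := sf_spatial_signs hxi; have [st sn sb] := sp.
have [sT sN _] := sf_signs hxi; have [sT' sN' _] := sf_signs hphi.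
have [st' sn' sb'] := sf_spatial_signs hphi.
have nV : qnorm V = Num.sqrt `|D|.
  rewrite /qnorm (qform_involute_V _ _ F st sn) normrM.
  by case: sT => ->; rewrite ?normrN1 ?normr1 mul1r.
have nU : qnorm U = Num.sqrt `|D|.
  rewrite /qnorm (qform_involute_U _ _ F st sn) !normrM.
  by case: sT => ->; case: sn => ->; rewrite ?normrN1 ?normr1 !mul1r.
have -> : en * eT * k ^+ 2 + eT * kappa ^+ 2 = eT * D by ring.
have -> : eT * k ^+ 2 + en * eT * kappa ^+ 2 = (en * eT) * D.
  transitivity ((en * en) * eT * k ^+ 2 + en * eT * kappa ^+ 2); last by ring.
  by rewrite (signV sn) mul1r.
rewrite -(qform_involute_V _ _ F st sn) -(qform_involute_U _ _ F st sn).
rewrite -/(qnorm V) -/(qnorm U).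
have N' : sf_N Fphi s' = (qnorm V)^-1 *: V.
  rewrite (sf_NE hphi Js) -[derive1n 2 _ _](scalerK u_neq0) hA normalizeZ.
  by rewrite gtr0_sg ?invr_gt0 // scale1r.
have E' : sf_E Fphi s' = - (etaE * en * eT) *: ((qnorm U)^-1 *: U).
  have [x x0 w] := qwedgeE; rewrite (sf_EE hphi Js) /= w normalizeZ.
  rewrite (serret_frenet_eta hphi Js) mul1r scalerA !sgrM (gtr0_sg x0) mul1r.
  congr (_ *: _); rewrite /etaE /= sgrM.
  have -> : Num.sg en = en by case: sn => ->; rewrite ?sgrN sgr1.
  have -> : Num.sg eT = eT by case: sT => ->; rewrite ?sgrN sgr1.
  ring.
split => //.
have D0 : D != 0.
  apply/eqP => D0; have := sf_N_neq0 hphi Js.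
  rewrite -[derive1n 2 _ _](scalerK u_neq0) hA qnormZ nV D0 normr0 sqrtr0 mulr0.
  by rewrite eqxx.
have q0 : Num.sqrt `|D| != 0 by rewrite gt_eqF // sqrtr_gt0 normr_gt0.
(* This is the sign of [D], written as it arises from the norms of [U] and [V]. *)
pose d := (Num.sqrt `|D|)^-1 ^+ 2 * D.
have eT'E : eps_T Fphi = eN.
  rewrite -(sf_hT hphi Js) hT qformZl qformZr (sf_hN hxi Is) mulrA.
  by rewrite (signV sN) mul1r.
have eN'E : eps_N Fphi = eT * d.
  rewrite -(sf_hN hphi Js) N' qformZl qformZr (qform_involute_V _ _ F st sn) nV.
  by rewrite /d; ring.
have TN' : qform (sf_T Fphi s') (sf_N Fphi s') = 0.
  by rewrite hT N' qformZl qformZr (qform_N_involute_V _ _ _ F) !mulr0.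
have prod' := frame_sign_prod (serret_frenet_frame hphi Js TN').
(* The sign product of the involute frame determines [d], once its first two signs are rewritten as
   [eN] and [eT * d] and [eN] as [et * eT]. *)
have key : eps_n Fphi * eps_T Fphi * eN * d = et * eps_b Fphi.
  have -> : d = eT * eps_N Fphi by rewrite eN'E mulrA (signV sT) mul1r.
  move: prod'; rewrite eT'E eNE; case: st => ->; case: sT => ->; case: sN' => ->;
    case: sn' => ->; case: sb' => ->; lra.
rewrite (sf_BE hphi Js) (serret_frenet_eta hphi Js) mul1r E' hT N'.
rewrite !qwedgeZl qwedgeZm qwedgeZr (qwedge_U_N_V _ _ F st) nU nV !scalerA.
congr (_ *: _).
transitivity (etaE * en * eb * (eT * eT) * (eps_n Fphi * eps_T Fphi * eN * d)).
  by rewrite /d; ring.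
by rewrite key (signV sT) /etaB; ring.
Qed.
End InvoluteApparatus.

(** * Differentiation along the curve and assembly *)

Theorem corollary3p1 (R : realType) (e : 'I_3 -> R) (I J : set R)
  (xi phi : R -> 'rV[R]_4) (Fxi Fphi : apparatus R) (sigma : R -> R) (c : R)
  (he : forall i, is_sign (e i))
  (oI : open I) (iI : is_interval I) (oJ : open J) (iJ : is_interval J)
  (hxi : serret_frenet e I xi Fxi) (hphi : serret_frenet e J phi Fphi)
  (hinv : involute_evolute I J sigma phi xi Fphi Fxi)
  (hc : forall s, I s -> phi (sigma s) = xi s + (c - s) *: sf_T Fxi s)
  (hsigma : forall s, I s ->
     is_derive s 1 sigma ((c - s) * sf_kappa Fxi s))
  (hsigma_gt0 : forall s, I s -> 0 < (c - s) * sf_kappa Fxi s)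
  (hw : w_curve I Fxi) :
  exists etaB etaE : R,
    [/\ is_sign etaB, is_sign etaE, etaE = eps_t Fxi * etaB &
     forall s, I s ->
     [/\ sf_T Fphi (sigma s) = eps_N Fxi *: sf_N Fxi s,
         sf_N Fphi (sigma s) =
           (Num.sqrt `|eps_n Fxi * eps_T Fxi * sf_k Fxi s ^+ 2
                       + eps_T Fxi * sf_kappa Fxi s ^+ 2|)^-1 *:
           (- (eps_t Fxi * sf_kappa Fxi s) *: sf_T Fxi s
            + (eps_n Fxi * eps_N Fxi * sf_k Fxi s) *: sf_B Fxi s),
         sf_B Fphi (sigma s) =
           (etaB * eps_n Fxi * eps_b Fxi * eps_b Fphi) *: sf_E Fxi s
       & sf_E Fphi (sigma s) =
           - (etaE * eps_n Fxi * eps_T Fxi) *: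
           ((Num.sqrt `|eps_T Fxi * sf_k Fxi s ^+ 2
                        + eps_n Fxi * eps_T Fxi * sf_kappa Fxi s ^+ 2|)^-1 *:
            ((eps_N Fxi * sf_k Fxi s) *: sf_T Fxi s
             + (eps_t Fxi * sf_kappa Fxi s) *: sf_B Fxi s))]].
Proof.
have [[a ha] [a' ha'] [a'' ha'']] := hw.
(* The constant sign of [k * tau], fixed before any point of [I] is given; a zero product is ruled
   out by [ktau] below. *)
pose g : R := if 0 < a' * a'' then 1 else -1.
have sg : is_sign g by rewrite /g; case: ifP; [left|right].
have [sT sN _] := sf_signs hxi; have [st sn sb] := sf_spatial_signs hxi.
have [sT' sN' _] := sf_signs hphi; have [st' sn' sb'] := sf_spatial_signs hphi.
pose etaE := g * (eps_n Fphi * eps_b Fphi * eps_T Fphi * eps_N Fphi).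
have sE : is_sign etaE by do !apply: signM.
exists (eps_t Fxi * etaE), etaE; split => //; first exact: signM.
  by rewrite mulrA (signV st) mul1r.
have Jsig s : I s -> J (sigma s) by case: hinv => lam h /h[].
pose u s := (c - s) * sf_kappa Fxi s.
have u0 s : I s -> u s != 0 by move=> Is; rewrite gt_eqF // hsigma_gt0.
have kap0 s : I s -> sf_kappa Fxi s != 0.
  by move=> /u0; rewrite mulf_eq0 negb_or => /andP[].
have dphi m s : (m < 3)%N -> I s ->
    is_derive s 1 (derive1n m phi \o sigma) (u s *: derive1n m.+1 phi (sigma s)).
  move=> m3 Is; apply: is_derive_compV; first exact: hsigma.
  by rewrite derive1nS derive1E; apply/derivableP/(sf_derivable hphi (Jsig _ Is)).
have dc (s : R) : is_derive s 1 (fun t => c - t) (-1 : R).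
  have := is_deriveB (is_derive_cst c s 1) (is_derive_id s 1).
  by rewrite sub0r.
have hT s : I s -> sf_T Fphi (sigma s) = eps_N Fxi *: sf_N Fxi s.
  move=> Is; apply: (scalerI (u0 _ Is)).
  have dxi : is_derive s 1 xi (sf_T Fxi s).
    by rewrite (sf_TE hxi Is) derive1E; apply/derivableP/(sf_derivable hxi Is (m := 0)).
  have := is_derive_near_unique oI Is hc (dphi 0%N s isT Is)
    (is_deriveD dxi (is_derive_scale (dc s) (sf_dT hxi Is))).
  rewrite (sf_TE hphi (Jsig _ Is)) => ->.
  (* The term [- T] from differentiating [c - s] cancels the derivative of [xi]. *)
  by rewrite scaleN1r addrCA subrr addr0 !scalerA; congr (_ *: _); rewrite /u; ring.
(* The involute condition says that [T] of [phi] is orthogonal to [T] of [xi], and the former is now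
   known to be [N] up to sign. *)
have TN s : I s -> qform (sf_T Fxi s) (sf_N Fxi s) = 0.
  move=> Is; case: hinv => lam /(_ s Is)[_ _].
  rewrite (hT s Is) qformZl qformC => /eqP; rewrite mulf_eq0 => /orP[|/eqP//].
  by case: sN => ->; rewrite ?oppr_eq0 oner_eq0.
pose V s := - (eps_t Fxi * sf_kappa Fxi s) *: sf_T Fxi s
  + (eps_n Fxi * eps_N Fxi * sf_k Fxi s) *: sf_B Fxi s.
have hA s : I s -> u s *: derive1n 2 phi (sigma s) = V s.
  move=> Is; have h t : I t -> (derive1n 1 phi \o sigma) t = eps_N Fxi *: sf_N Fxi t.
    by move=> It; rewrite -(hT t It) (sf_TE hphi (Jsig _ It)).
  rewrite (is_derive_near_unique oI Is h (dphi 1%N s isT Is)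
    (is_deriveZ (eps_N Fxi) (sf_dN hxi Is))).
  rewrite scalerDr !scalerA /V; congr (_ *: _ + _ *: _); last by ring.
  transitivity (- (eps_t Fxi * (eps_N Fxi * eps_N Fxi) * sf_kappa Fxi s)).
    by ring.
  by rewrite (signV sN) mulr1.
have hA3 s : I s -> exists y z,
    u s *: (u s *: derive1n 3 phi (sigma s)) = y *: derive1n 2 phi (sigma s)
    + (z *: sf_N Fxi s + (eps_N Fxi * sf_k Fxi s * sf_tau Fxi s) *: sf_E Fxi s).
  (* Constancy of the curvatures enters here: [u] has derivative [- a], and [V] has constant
     coefficients, so its derivative involves only [N] and [E]. *)
  move=> Is; have du : is_derive s 1 (fun t => (c - t) * a) (- a : R).
    have := is_deriveM (dc s) (is_derive_cst a s 1).
    by rewrite /GRing.scale /= mulr0 add0r mulrN1.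
  have dV := is_deriveD (is_deriveZ (- (eps_t Fxi * a)) (sf_dT hxi Is))
    (is_deriveZ (eps_n Fxi * eps_N Fxi * a') (sf_dB hxi Is)).
  have h t : I t -> ((c - t) * a) *: derive1n 2 phi (sigma t) =
     - (eps_t Fxi * a) *: sf_T Fxi t + (eps_n Fxi * eps_N Fxi * a') *: sf_B Fxi t.
    by move=> It; rewrite -{1}(ha t It) -/(u t) (hA t It) /V (ha t It) (ha' t It).
  have := is_derive_near_unique oI Is h
    (is_derive_scale du (dphi 2%N s isT Is)) dV.
  rewrite -{1}(ha s Is) -/(u s) => /(canRL (addrK _)) ->.
  (* [a] is [- u'] moved to the right-hand side; the second witness sums the [N] components of the
     [T'] and [B'] terms. *)
  exists a, (- (eps_t Fxi * eps_N Fxi *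
    (sf_kappa Fxi s ^+ 2 + eps_n Fxi * sf_k Fxi s ^+ 2))).
  rewrite (scaleNr a) opprK addrC; congr (_ + _).
  rewrite scalerDr !scalerA addrA -scalerDl -(ha s Is) -(ha' s Is).
  congr (_ *: _ + _ *: _); first by ring.
  transitivity ((eps_n Fxi * eps_n Fxi) * eps_N Fxi * sf_k Fxi s * sf_tau Fxi s).
    by ring.
  by rewrite (signV sn) mul1r.
have ktau s : I s -> sf_k Fxi s * sf_tau Fxi s != 0.
  move=> Is; have [y [z h]] := hA3 s Is.
  exact: (involute_torsion_neq0 hxi hphi Is (Jsig _ Is) (hsigma_gt0 s Is)
    (TN s Is) (hT s Is) (hA s Is) h).
have k0 s : I s -> sf_k Fxi s != 0.
  by move=> /ktau; rewrite mulf_eq0 negb_or => /andP[].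
move=> s Is; have [y [z h]] := hA3 s Is.
have eNE := serret_frenet_spatial_sign he oI hxi kap0 k0 TN Is.
have := involute_apparatus hxi hphi Is (Jsig _ Is) (hsigma_gt0 s Is)
  (TN s Is) (hT s Is) (hA s Is) h eNE.
have -> : Num.sg (sf_k Fxi s * sf_tau Fxi s) = g.
  rewrite /g -(ha' s Is) -(ha'' s Is).
  by case: (ltrgt0P (sf_k Fxi s * sf_tau Fxi s)) (ktau s Is) =>
    [/gtr0_sg ->|/ltr0_sg ->|->]; rewrite ?eqxx.
by case=> h1 h2 h3; split; [exact: hT|exact: h1|exact: h2|exact: h3].
Qed.
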